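(* The subset $IP(k)$ of $\mathbb Z$ has Banach density zero, that is, $$\lim_{\#I\to\infty}\frac{\#(I\cap IP(k))}{\#I}=0$$ as $I$ varies over the finite intervals in $\mathbb Z$.
   Context: Fix an odd integer $b\ge 5$. Define $k:\mathbb Z\to\mathbb Z$ by $k(n)=b^{n-1}$ for $n\ge1$, $k(0)=0$ and $k(-n)=-k(n)$. $IP(k)\subset\mathbb Z$ is the set of sums of finite subsets of the image set $k(\mathbb Z)$. *)

(* Defs.v *)
From mathcomp Require Import all_boot all_order all_algebra.
From mathcomp Require Import finmap.
From mathcomp Require Import all_classical all_reals all_analysis.

Set Implicit Arguments.
Unset Strict Implicit.
Unset Printing Implicit Defensive.

Import Order.TTheory GRing.Theory Num.Theory.
Import numFieldNormedType.Exports.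

Local Open Scope classical_set_scope.
Local Open Scope ring_scope.

Definition k (b n : int) : int :=
  if 0 < n then b ^+ `|n|%N.-1
  else if n == 0 then 0
  else - b ^+ `|n|%N.-1.

(* Each element of the image of [f] is used at most once in a sum; the empty
   sum is allowed. *)
Definition IP (f : int -> int) : set int :=
  [set s | exists F : {fset int},
             [set` F] `<=` range f /\ s = (\sum_(x <- F) x)%R].

Definition finite_interval (I : set int) : Prop :=
  finite_set I /\ is_interval I.

(* [fset_set] sends infinite sets to the empty one, so this is the cardinality
   for finite sets only. *)
Definition card_set (I : set int) : nat := #|` fset_set I|.

(* The filter of "#I tends to infinity, I a finite interval of Z". *)
Definition large_intervals : set_system (set int) :=
  filter_from [set: nat]
    (fun N => [set I | finite_interval I /\ (N <= card_set I)%N]).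

Lemma finite_interval_of_card (N : nat) :
  exists2 I, finite_interval I & card_set I = N.
Proof.
pose F : {fset int} := [fset Posz n | n in iota 0 N]%fset.
have FE (x : int) : (x \in F) = (0 <= x < N%:Z).
  apply/imfsetP/andP => [[n /= + ->]|[x0 xN]].
    by rewrite mem_iota add0n /= ltz_nat.
  case: x x0 xN => // n _; rewrite ltz_nat => nN.
  by exists n => //=; rewrite mem_iota.
exists [set` F]; first split.
- exact: finite_fset.
- move=> x y /=; rewrite !FE => /andP[x0 _] /andP[_ yN] z /andP[xz zy].
  by rewrite FE (le_trans x0 xz) (le_lt_trans zy yN).
- rewrite /card_set set_fsetK card_imfset /=; last by move=> m n [].
  by rewrite undup_id ?iota_uniq // size_iota.
Qed.

#[global] Instance large_intervals_filter : ProperFilter large_intervals.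
Proof.
apply: filter_from_proper; last first.
  move=> N _; have [I finI cI] := finite_interval_of_card N.
  by exists I; split=> //; rewrite cI.
apply: filter_from_filter; first by exists 0%N.
move=> M N _ _; exists (maxn M N) => // I [finI].
by rewrite geq_max => /andP[MI NI]; split.
Qed.

Definition banach_density_zero (R : realType) (A : set int) : Prop :=
  (card_set (I `&` A))%:R / (card_set I)%:R @[I --> large_intervals]
    --> (0 : R).

(* Main.v *)
Require Import Defs.
From mathcomp Require Import all_boot all_order all_algebra.
From mathcomp Require Import finmap zify.
From mathcomp Require Import all_classical all_reals all_analysis.

Local Open Scope ring_scope.

Import Order.TTheory GRing.Theory Num.Theory.
Import numFieldNormedType.Exports.

(** An element of IP(k) is a sum of distinct numbers among 0 and +-b^j.  The
    summands prime to b are at most 1 and -1, so they add up to a digit in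
    {-1, 0, 1}; the other summands, divided by b, are again distinct values
    of k.  Hence A = IP(k) satisfies A <= {-1, 0, 1} + b A
    ([IP_self_similar]), a digit expansion in base b that uses only 3 of the
    b residues.

    Any set A <= D + b A with #D < b has Banach density zero
    ([self_similar_density_zero]).  The points of A in a window of length
    b L with a given last digit e in D come, through the injective map
    x = e + b y, from points y of A in a window of length L; so if every
    window of length L contains at most M points of A, every window of length
    b L contains at most #D M of them.  By induction a window of length b^n
    contains at most #D^n points.  An interval of m integers is covered by
    m / b^n + 1 such windows, so the proportion of A in it is at most
    (#D / b)^n + #D^n / m: choose n to make the first term small, then m large
    to make the second one small. *)

(** * Counting points in windows *)

(** Finite subsets of the window are represented by duplicate-free
    sequences, so that they can be filtered and mapped freely. *)
Definition window_bound (A : set int) (L : int) (M : nat) : Prop :=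
  forall (a : int) (s : seq int), uniq s ->
    (forall x, x \in s -> A x /\ a <= x < a + L) -> (size s <= M)%N.

Definition self_similar (b : int) (D : seq int) (A : set int) : Prop :=
  forall x, A x -> exists e y, [/\ e \in D, A y & x = e + b * y].

Lemma window_bound1 (A : set int) : window_bound A 1 1.
Proof.
move=> a s us sA; apply: (@uniq_leq_size _ _ [:: a]) => // x /sA[_ xa].
by rewrite inE; apply/eqP; lia.
Qed.

(** A window of length q L is a union of q windows of length L; induction
    on q splits off the leftmost one. *)
Lemma window_bound_mul (A : set int) (L : int) (M q : nat) :
  window_bound A L M -> window_bound A (L * q%:Z) (M * q).
Proof.
move=> AL; elim: q => [|q IHq] a s us sA.
  case: s us sA => [|x s] _ sA; first by rewrite muln0.
  by have [_] := sA x (mem_head _ _); lia.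
rewrite -(count_predC (fun x => x < a + L) s) -!size_filter mulnS leq_add //.
  apply: (AL a); first exact: filter_uniq.
  by move=> x; rewrite mem_filter => /andP[xL /sA[Ax xa]]; split=> //; lia.
apply: (IHq (a + L)); first exact: filter_uniq.
by move=> x; rewrite mem_filter /= => /andP[xL /sA[Ax xa]]; split=> //; nia.
Qed.

(** The points with a fixed last digit e are counted by their quotients by b,
    which determine them and lie in a window b times shorter. *)
Lemma window_bound_digit (A : set int) (b e L : int) (M : nat) (a : int)
    (s : seq int) : 0 < b -> window_bound A L M -> uniq s ->
  (forall x, x \in s -> (exists2 y, A y & x = e + b * y)
                        /\ a <= x < a + b * L) ->
  (size s <= M)%N.
Proof.
move=> b0 AL us sA; rewrite -(size_map (fun x => ((x - e) %/ b)%Z)).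
have quoE y : ((e + b * y - e) %/ b)%Z = y.
  by rewrite addrAC subrr add0r mulKz ?gt_eqF.
(* a <= e + b y amounts to y >= (a - e) / b rounded up, that is to
   y >= - floor ((e - a) / b). *)
apply: (AL (- ((e - a) %/ b)%Z)).
  rewrite map_inj_in_uniq // => x x' /sA[[y _ ->] _] /sA[[y' _ ->] _].
  by rewrite !quoE => ->.
move=> _ /mapP[x /sA[[y Ay ->] xa] ->]; rewrite quoE; split=> //.
have := divz_eq (e - a) b; have := modz_ge0 (e - a) (lt0r_neq0 b0).
have := ltz_pmod (e - a) b0.
set c := ((e - a) %/ b)%Z; set r := ((e - a) %% b)%Z => rb r0 ea.
have [lo hi] : b * (y + c) + b > 0 /\ b * (y + c) < b * L by split; lia.
have {lo} : b * (y + c + 1) > 0 by lia.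
rewrite pmulr_rgt0 // => lo; move: hi; rewrite ltr_pM2l // => hi; lia.
Qed.

(** Each of the #D possible last digits contributes at most M points. *)
Lemma window_bound_self_similar (A : set int) (b L : int) (D : seq int)
    (M : nat) : 0 < b -> self_similar b D A -> window_bound A L M ->
  window_bound A (b * L) (size D * M).
Proof.
move=> b0 AD AL a s us sA.
have {AD sA} sD x : x \in s -> (exists e y, [/\ e \in D, A y & x = e + b * y])
    /\ a <= x < a + b * L.
  by move=> /sA[Ax xa]; split=> //; exact: AD.
(* Only the last digits of the elements of s have to lie in D, and not those of
   all of A: this is what makes an induction on D possible. *)
elim: D s us sD => [|e D IHD] s us sD.
  by case: s us sD => // x s _ /(_ x (mem_head _ _))[[e [y []]]].
pose P x := `[< exists2 y, A y & x = e + b * y >].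
rewrite -(count_predC P s) -!size_filter mulSn leq_add //.
  apply: (@window_bound_digit A b e L M a) => //; first exact: filter_uniq.
  by move=> x; rewrite mem_filter => /andP[/asboolP Px /sD[_ xa]].
apply: IHD; first exact: filter_uniq.
move=> x; rewrite mem_filter => /andP[/asboolPn nPx /sD[[e' [y []]]]].
rewrite inE => /predU1P[-> Ay xE xa|De' Ay xE xa]; first by case: nPx; exists y.
by split=> //; exists e', y.
Qed.

Lemma window_bound_expr (A : set int) (b : int) (D : seq int) (n : nat) :
  0 < b -> self_similar b D A -> window_bound A (b ^+ n) (size D ^ n).
Proof.
move=> b0 AD; elim: n => [|n IHn]; first exact: window_bound1.
by rewrite exprS expnS; exact: window_bound_self_similar.
Qed.

(** * From windows to Banach density *)

(** The window starts at the least element a of I: if x is in I, then so are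
    the x - a + 1 integers between a and x, whence x - a < #I. *)
Lemma finite_interval_window (I : set int) : finite_interval I ->
  exists a, forall x, I x -> a <= x < a + (card_set I)%:Z.
Proof.
move=> [finI itvI].
have mem_I x : (x \in fset_set I) = (x \in I) by exact: in_fset_set.
have [r r_sorted mem_r] :
    exists2 r : seq int, sorted <=%R r & forall x, (x \in r) = (x \in I).
  exists (sort <=%R (fset_set I)); first exact: sort_le_sorted.
  by move=> x; rewrite mem_sort.
case: r r_sorted mem_r => [|a s] + mem_s.
  (* I is empty, and any starting point will do. *)
  by move=> _; exists 0 => x /mem_set; rewrite -mem_s.
move=> /= /(order_path_min le_trans)/allP a_le.
have Ia : I a by apply/set_mem; rewrite -mem_s mem_head.
exists a => x Ix.
have ax : a <= x.
  by have /mem_set := Ix; rewrite -mem_s inE => /predU1P[->|/a_le].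
rewrite ax /=.
have : (size [seq (a + i%:Z)%R | i <- iota 0 `|(x - a)%R|.+1] <= card_set I)%N.
  apply: uniq_leq_size.
    by rewrite map_inj_uniq ?iota_uniq // => i j /addrI[].
  move=> z /mapP[i]; rewrite mem_iota => ilt ->.
  by rewrite mem_I; apply/mem_set/(itvI a x) => //; lia.
by rewrite size_map size_iota; lia.
Qed.

Lemma card_interval_le (A I : set int) (L M : nat) : (0 < L)%N ->
  window_bound A L%:Z M -> finite_interval I ->
  (card_set (I `&` A) <= M * (card_set I %/ L).+1)%N.
Proof.
move=> L0 AL finI; have [a Ia] := finite_interval_window I finI.
have finIA : finite_set (I `&` A)%classic.
  by case: finI => + _; apply: sub_finite_set => x [].
apply: (window_bound_mul A L%:Z M _ AL a); first exact: fset_uniq.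
move=> x; rewrite in_fset_set // => /set_mem[/Ia xa Ax]; split=> //.
by have := ltn_ceil (card_set I) L0; lia.
Qed.

(** The estimate #(I & A) / #I <= (#D / b)^n + #D^n / #I, in which n is chosen
    before the lower bound on #I. *)
Theorem self_similar_density_zero (R : realType) (A : set int) (b : nat)
    (D : seq int) : (size D < b)%N -> self_similar b%:Z D A ->
  banach_density_zero R A.
Proof.
move=> Db AD; have b0 : (0 < b)%N by apply: leq_trans Db.
have bR0 : 0 < b%:R :> R by rewrite ltr0n.
apply/cvgrPdist_lt => e e0; have e20 : 0 < e / 2 by rewrite divr_gt0.
pose d : R := (size D)%:R.
have [n dn] : exists n, (d / b%:R) ^+ n < e / 2.
  have : `|d / b%:R| < 1.
    by rewrite ger0_norm ?divr_ge0 // ltr_pdivrMr // mul1r ltr_nat.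
  move=> /cvg_expr /cvgrPdist_lt /(_ _ e20)[n _ /(_ n (leqnn n))] /=.
  by rewrite sub0r normrN => /(le_lt_trans (ler_norm _)); exists n.
pose M := (size D ^ n)%N.
(* #I > #D^n / (e / 2) makes the second term smaller than e / 2. *)
exists (Num.truncn (M%:R / (e / 2))).+1 => // I [finI cardI].
set m := card_set I in cardI *; set c := card_set _.
have m0 : 0 < m%:R :> R by rewrite ltr0n; apply: leq_trans cardI.
rewrite sub0r normrN ger0_norm ?divr_ge0 //.
have AL : window_bound A (b ^ n)%N%:Z M.
  by rewrite -natz natrX natz; exact: window_bound_expr.
have L0 : (0 < b ^ n)%N by rewrite expn_gt0 b0.
have c_le : (c <= M * (m %/ b ^ n).+1)%N by exact: card_interval_le.
have Mm : M%:R < e / 2 * m%:R.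
  rewrite mulrC -ltr_pdivrMr //; apply: lt_le_trans (truncnS_gt _) _.
  by rewrite ler_nat.
have qm : M%:R * (m %/ b ^ n)%:R <= (d / b%:R) ^+ n * m%:R.
  rewrite exprMn exprVn -!natrX -mulrA ler_wpM2l // mulrC ler_pdivlMr ?ltr0n //.
  by rewrite -natrM ler_nat leq_divM.
rewrite ltr_pdivrMr //; apply: le_lt_trans (_ : M%:R * (m %/ b ^ n).+1%:R < _).
  by rewrite -natrM ler_nat.
rewrite -natr1 mulrDr mulr1 [e]splitr mulrDl.
by apply: ler_ltD => //; apply: le_trans qm _; rewrite ler_wpM2r // ltW.
Qed.

(** * The digits of IP(k) *)

Lemma range_kP (b x : int) :
  range (k b) x <-> x = 0 \/ exists j : nat, x = b ^+ j \/ x = - b ^+ j.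
Proof.
rewrite /k; split=> [[n _ <-]|].
  case: ifP => _; first by right; exists `|n|.-1; left.
  by case: ifP => _; [left|right; exists `|n|.-1; right].
case=> [->|[j [->|->]]]; first by exists 0.
- by exists j.+1%:Z.
- by exists (- j.+1%:Z).
Qed.

Lemma range_k_div (b x : int) : 1 < b -> (b %| x)%Z ->
  range (k b) x -> range (k b) (x %/ b)%Z.
Proof.
move=> b1 bx /range_kP xk; apply/range_kP.
have b0 : b != 0 by rewrite gt_eqF // (lt_trans _ b1).
have nb1 : ~~ (b %| 1)%Z by rewrite dvdz1; lia.
case: xk bx => [->|[[|j] [->|->]]] bx; first by left; rewrite div0z.
- by rewrite expr0 (negPf nb1) in bx.
- by rewrite expr0 dvdzE abszN -dvdzE (negPf nb1) in bx.
- by right; exists j; left; rewrite exprS mulKz.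
- by right; exists j; right; rewrite exprS -mulrN mulKz.
Qed.

Lemma range_k_ndvd (b x : int) : ~~ (b %| x)%Z -> range (k b) x ->
  x \in [:: 1; -1].
Proof.
move=> bx /range_kP xk; case: xk bx => [->|[[|j] [->|->]]].
- by rewrite dvdz0.
- by [].
- by [].
- by rewrite exprS dvdz_mulr.
- by rewrite exprS dvdzE abszN -dvdzE dvdz_mulr.
Qed.

(** The sum has at most two terms, and cancels if it has both. *)
Lemma sum_units (s : seq int) : uniq s -> {subset s <= [:: 1; -1]} ->
  \sum_(x <- s) x \in [:: -1; 0; 1].
Proof.
move=> us ss; have sE : perm_eq s [seq x <- [:: 1; -1] | x \in s].
  apply: uniq_perm => //; first by rewrite filter_uniq.
  by move=> x; rewrite mem_filter; case: (boolP (x \in s)) => // /ss ->.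
rewrite (perm_big _ sE) /=.
by case: ifP => _; case: ifP => _; rewrite !(big_cons, big_nil).
Qed.

(** Splitting a sum of distinct values of k into the terms prime to b, which
    make up the last digit, and the multiples of b; dividing the latter by b
    keeps them distinct and in the range of k. *)
Lemma IP_self_similar (b : int) : 1 < b ->
  self_similar b [:: -1; 0; 1] (IP (k b)).
Proof.
move=> b1 _ [F [Fk ->]].
have b0 : b != 0 by rewrite gt_eqF // (lt_trans _ b1).
pose G := [fset (x %/ b)%Z | x in [fset x in F | (b %| x)%Z]]%fset.
exists (\sum_(x <- F | ~~ (b %| x)%Z) x), (\sum_(y <- G) y); split.
- rewrite -big_filter; apply: sum_units; first exact: filter_uniq (fset_uniq F).
  move=> x; rewrite mem_filter => /andP[bx /Fk]; exact: range_k_ndvd.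
- exists G; split=> // _ /imfsetP[x /= + ->]; rewrite !inE => /andP[xF bx].
  by apply: range_k_div => //; exact: Fk.
rewrite (bigID (fun x => (b %| x)%Z)) /= addrC; congr (_ + _).
rewrite big_imfset /= => [|x x']; last first.
  rewrite !inE => /andP[_ bx] /andP[_ bx'] eq_quo.
  by rewrite -(divzK bx) eq_quo divzK.
rewrite big_fset mulr_sumr /=; apply: eq_bigr => x bx.
by rewrite mulrC divzK.
Qed.

Theorem theorem3p7 (R : realType) (b : int) (hodd : odd `|b|%N) (hb : 5 <= b) :
  banach_density_zero R (IP (k b)).
Proof.
case: b hodd hb => // b _ b5.
apply: (@self_similar_density_zero R _ b [:: -1; 0; 1]).
  by move=> /=; lia.
by apply: IP_self_similar; lia.
Qed.
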